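(* Let $a\in\mathbb{R}_+$, $I_a=[a,\infty)$, and let $(X,d,a)$ be a complete O-metric space with $d:X\times X\to I_a$. Let $\{\Delta_n\}_{n\in\mathbb{N}}$ be functions $\Delta_n:I_a^n\to\mathbb{R}_+$ such that: (i) for all $x_1,x_2\in X$, $d(x_1,x_2)=a \Longleftrightarrow x_1=x_2$; (ii) for all $x_1,x_2\in X$, $d(x_1,x_2)=d(x_2,x_1)$; (iii) for each $n\in\mathbb{N}$, $\Delta_n$ is non-decreasing in all variables, and for all $x_0,x_1,\ldots,x_n\in X$, $$d(x_0,x_n)\le\Delta_n(d(x_0,x_1),d(x_1,x_2),\ldots,d(x_{n-1},x_n)).$$ Suppose $T:X\to X$ is a map such that for all $x,y\in X$, $d(Tx,Ty)\le\psi(d(x,y))$, where $\psi:I_a\to I_a$ is a non-decreasing function, continuous at $a$, with $\psi(a)=a$ and: (iv) for all $t\in I_a$, $\lim_{n\to\infty}\psi^n(t)=a$; (v) for all $i\in\mathbb{N}$, $\lim_{t\to a}\Delta_i\left(\psi(t),\psi^2(t),\ldots,\psi^i(t)\right)=a$. If either $T$ is continuous, or $\Delta_2$ is continuous at $(a,a)$ with $\Delta_2(a,a)=a$, then $T$ has a unique fixed point.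
   Context: $\mathbb{R}_+=[0,\infty)$. Here $\psi^n$ denotes the $n$-fold composition of $\psi$ with itself. Let $X$ be a non-empty set, $a\in\mathbb{R}_+$, $I_a\subset\mathbb{R}_+$ an interval containing $a$, and $\mathbf{o}:I_a\times I_a\to\mathbb{R}_+$ a function. A function $d:X\times X\to I_a$ is an O-metric on $X$, and $(X,d,a)$ is an O-metric space, if for all $x,y,z\in X$: $d(x,y)=a$ if and only if $x=y$; $d(x,y)=d(y,x)$; and $d(x,z)\le \mathbf{o}(d(x,y),d(y,z))$. A sequence $\{x_n\}$ in $X$ converges to $x\in X$ if $\lim_{n\to\infty}d(x_n,x)=a$; it is Cauchy if $\lim_{n,m\to\infty}d(x_n,x_m)=a$; $(X,d,a)$ is complete if every Cauchy sequence converges in $X$. With $B(x,r)=\{y\in X:|d(x,y)-a|<r\}$ for $r>0$, $X$ is endowed with the O-metric topology $\{A\subset X:\forall x\in A\ \exists r>0,\ B(x,r)\subset A\}$. *)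

(* Defs.v *)
From HB Require Import structures.
From mathcomp Require Import all_boot all_order all_algebra.
From mathcomp Require Import all_classical all_reals all_analysis.
Set Implicit Arguments.
Unset Strict Implicit.
Unset Printing Implicit Defensive.
Import Order.TTheory GRing.Theory Num.Theory.
Import numFieldNormedType.Exports.
Local Open Scope classical_set_scope.
Local Open Scope ring_scope.

(* Functions defined on I (or on I x I, I^n) are total functions on R, of which
   only the restriction to I (resp. I x I, I^n) is ever constrained or used. *)

Record O_metric_space (R : realType) (X : Type) (a : R) (I : interval R)
    (o : R -> R -> R) (d : X -> X -> R) : Prop := OMetricSpace {
  O_inhabited : inhabited X ;
  O_base_ge0 : 0 <= a ;
  O_itv_ge0 : {subset I <= `[0, +oo[} ;
  O_base_itv : a \in I ;
  O_fun_ge0 : {in I &, forall u v, 0 <= o u v} ;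
  O_dist_itv : forall x y, d x y \in I ;
  O_dist_eq : forall x y, d x y = a <-> x = y ;
  O_dist_sym : forall x y, d x y = d y x ;
  O_dist_triangle : forall x y z, d x z <= o (d x y) (d y z)
}.

Section OTopology.
Context {R : realType} {X : Type}.
Implicit Types (a : R) (d : X -> X -> R).

Definition O_cvg a d (u : nat -> X) (x : X) := d (u n) x @[n --> \oo] --> a.

Definition O_cauchy a d (u : nat -> X) :=
  d (u p.1) (u p.2) @[p --> filter_prod \oo \oo] --> a.

Definition O_complete a d :=
  forall u : nat -> X, O_cauchy a d u -> exists x, O_cvg a d u x.

Definition O_ball a d (x : X) (r : R) : set X := [set y | `|d x y - a| < r].

Definition O_open a d (A : set X) :=
  forall x, A x -> exists2 r : R, 0 < r & O_ball a d x r `<=` A.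

Definition O_space a d : Type := X.

Lemma O_openT a d : O_open a d setT.
Proof. by move=> x _; exists 1. Qed.

Lemma O_openI a d : setI_closed (O_open a d).
Proof.
move=> A B oA oB x [/oA[r r0 rA] /oB[s s0 sB]].
exists (Num.min r s); first by rewrite lt_min r0 s0.
move=> y; rewrite /O_ball /= lt_min => /andP[yr ys].
by split; [exact: rA|exact: sB].
Qed.

Lemma O_open_bigU a d (J : Type) (f : J -> set X) :
  (forall j, O_open a d (f j)) -> O_open a d (\bigcup_j f j).
Proof.
move=> of_ x [j _ /of_[r r0 rf]]; exists r => // y /rf fy.
by exists j.
Qed.

HB.instance Definition _ a d := gen_eqMixin (O_space a d).
HB.instance Definition _ a d := gen_choiceMixin (O_space a d).
HB.instance Definition _ a d := isOpenTopological.Build (O_space a d)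
  (@O_openT a d) (@O_openI a d) (@O_open_bigU a d).

Lemma O_space_openE a d (A : set (O_space a d)) : open A <-> O_open a d A.
Proof.
rewrite openE; split=> [oA x /oA[B [oB Bx BA]]|oA x Ax].
  by have [r r0 rB] := oB x Bx; exists r => //; exact: subset_trans rB BA.
by rewrite /interior; exists A; split.
Qed.

End OTopology.

Definition continuous_at_within (S T : topologicalType) (A : set S)
    (f : S -> T) (x : S) := f y @[y --> within A (nbhs x)] --> f x.

(* I^n, with points of R^n represented as row vectors *)
Definition cube (R : realType) (I : interval R) (n : nat) : set 'rV[R]_n :=
  [set v | forall i, v ord0 i \in I].
Arguments cube {R} I n.

Definition nondecreasing_in_each_variable (R : realType) (I : interval R)
    (n : nat) (f : 'rV[R]_n -> R) :=
  forall (j : 'I_n) (u v : 'rV[R]_n), cube I n u -> cube I n v ->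
    (forall k, k != j -> u ord0 k = v ord0 k) ->
    u ord0 j <= v ord0 j -> f u <= f v.

(* Main.v *)
(* Write x_n = T^n x. If psi t = a for some t > a, the orbit reaches a fixed
   point after finitely many steps, since psi^n (d x (T x)) drops below t.
   Otherwise psi t and psi^2 t exceed a whenever t > a, so monotonicity of
   Delta_2 and (v) for i = 2 give a uniform weak triangle inequality: d x z is
   close to a as soon as d x y and d y z are. Choose delta for eps = 1, m with
   psi^m (a + 1) < a + delta, and then n with d (x_n, x_(n+j)) close to a for
   all j <= m. Going through x_(n+m), an induction on j gives
   d (x_n, x_(n+j)) <= a + 1 for all j, hence
   d (x_(n+k), x_(n+k+j)) <= psi^k (a + 1) and the orbit is Cauchy. Its limit z
   satisfies d (z, x_n) -> a and d (x_n, T z) -> a, so d (z, T z) = a by the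
   weak triangle inequality again. *)
Require Import Defs.
From HB Require Import structures.
From mathcomp Require Import all_boot all_order all_algebra.
From mathcomp Require Import all_classical all_reals all_analysis.
Import Order.TTheory GRing.Theory Num.Theory.
Import numFieldNormedType.Exports.
Local Open Scope classical_set_scope.
Local Open Scope ring_scope.

Set Implicit Arguments.
Unset Strict Implicit.

Lemma nondecreasing_in_each_variable_le (R : realType) (I : interval R)
    (n : nat) (f : 'rV[R]_n -> R) (u v : 'rV[R]_n) :
  nondecreasing_in_each_variable I f -> cube I n u -> cube I n v ->
  (forall i, u ord0 i <= v ord0 i) -> f u <= f v.
Proof.
move=> fnd Iu Iv uv.
(* Monotonicity is only given one variable at a time, so [u] is turned into [v] through hybrids:
   [w k] has the first [k] entries of [v] and the remaining ones of [u]. *)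
pose w k : 'rV[R]_n := \row_i if (i < k)%N then v ord0 i else u ord0 i.
have Iw k : cube I n (w k) by move=> i; rewrite mxE; case: ifP.
have w0 : w 0%N = u by apply/rowP => i; rewrite mxE.
have wn : w n = v by apply/rowP => i; rewrite mxE ltn_ord.
suff fw k : (k <= n)%N -> f u <= f (w k) by rewrite -wn fw.
elim: k => [|k IH] kn; first by rewrite w0.
apply: (le_trans (IH (ltnW kn))).
apply: (fnd (Ordinal kn)) => // [i ik|]; rewrite !mxE /= ?ltnn ?ltnSn //.
by rewrite ltnS [(i <= k)%N]leq_eqVlt -[_ == _ :> nat]/(i == Ordinal kn)
  (negbTE ik).
Qed.

Definition weak_triangle (R : realType) (X : Type) (a : R) (d : X -> X -> R) :=
  forall e : R, 0 < e -> exists2 r : R, 0 < r &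
    forall x y z, d x y <= a + r -> d y z <= a + r -> d x z <= a + e.

Section Orbits.
Context {R : realType} {X : Type} (a : R) (d : X -> X -> R)
  (T : X -> X) (psi : R -> R).
Context (d_ge : forall x y, a <= d x y)
  (d_sym : forall x y, d x y = d y x)
  (d_eq : forall x y, d x y = a <-> x = y)
  (d_T : forall x y, d (T x) (T y) <= psi (d x y))
  (psi_ge : forall t, a <= t -> a <= psi t)
  (psi_nd : forall s t, a <= s -> s <= t -> psi s <= psi t)
  (psi_cvg : forall t, a <= t -> iter n psi t @[n --> \oo] --> a).

Lemma iter_psi_ge n t : a <= t -> a <= iter n psi t.
Proof. by move=> at_; elim: n => //= n; exact: psi_ge. Qed.

Lemma iter_psi_nd n s t : a <= s -> s <= t -> iter n psi s <= iter n psi t.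
Proof.
by move=> as_ st; elim: n => //= n; apply: psi_nd; exact: iter_psi_ge.
Qed.

Lemma d_iter n x y : d (iter n T x) (iter n T y) <= iter n psi (d x y).
Proof.
by elim: n => //= n IH; apply: (le_trans (d_T _ _)); exact: psi_nd.
Qed.

Lemma iter_psi_lt t e : a <= t -> 0 < e ->
  exists N, forall n, (N <= n)%N -> iter n psi t < a + e.
Proof.
move=> at_ e0; have ae : a < a + e by rewrite ltrDl.
by have [N _ HN] := cvgr_lt _ (psi_cvg at_) _ ae; exists N.
Qed.

(** If [t < psi t], monotonicity keeps every later iterate at or above [psi t], which contradicts
    convergence to [a]. *)
Lemma psi_le_id t : a <= t -> psi t <= t.
Proof.
move=> at_; rewrite leNgt; apply/negP => tp.
have pn n : psi t <= iter n.+1 psi t.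
  elim: n => // n IH; rewrite iterS psi_nd //.
  exact: le_trans (ltW tp) IH.
have [|N /(_ N.+1 (leqnSn N))] := @iter_psi_lt t (psi t - a) at_.
  by rewrite subr_gt0 (le_lt_trans at_).
by rewrite addrC subrK ltNge pn.
Qed.

Lemma d_le_eq x y : d x y <= a -> x = y.
Proof. by move=> dxy; apply/d_eq/le_anti; rewrite dxy d_ge. Qed.

Lemma d_le_eps_eq x y : (forall e, 0 < e -> d x y <= a + e) -> x = y.
Proof. by move=> dxy; apply: d_le_eq; apply/ler_addgt0Pr. Qed.

(** Iterating [T] moves neither point, so [d x y] is bounded by every [iter n psi (d x y)], and
    these tend to [a]. *)
Lemma contraction_fixed_unique x y : T x = x -> T y = y -> x = y.
Proof.
move=> Tx Ty; apply: d_le_eps_eq => e e0.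
have [N /(_ N (leqnn N)) /ltW] := iter_psi_lt (d_ge x y) e0.
apply: le_trans; apply: le_trans (d_iter _ _ _).
by rewrite !iter_fix.
Qed.

Lemma orbit_reaches_fixed t (x : X) : a < t -> psi t = a -> exists z, T z = z.
Proof.
move=> at_ pt.
have [|N /(_ N (leqnn N))] := @iter_psi_lt (d x (T x)) (t - a) (d_ge _ _).
  by rewrite subr_gt0.
(* After [N] steps the bound is at most [t]; one more application of [psi] brings it to [psi t = a],
   so the next two orbit points coincide. *)
rewrite addrC subrK => /ltW pN; exists (iter N.+1 T x); symmetry.
apply: d_le_eq; rewrite -iterS [iter N.+2 T x]iterSr.
apply: (le_trans (d_iter _ _ _)); rewrite -pt /=.
by apply: psi_nd => //; exact: iter_psi_ge.
Qed.

Context (wtri : weak_triangle a d).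

(** Induction on [j] through the intermediate point [iter (n + j) T x], whose distance to its
    successor is at most [iter (n + j) psi (d x (T x))]. The threshold [N] depends on [j]. *)
Lemma orbit_shift_small x j e : 0 < e ->
  exists N, forall n, (N <= n)%N -> d (iter n T x) (iter (n + j) T x) <= a + e.
Proof.
elim: j e => [|j IH] e e0.
  exists 0%N => n _; rewrite addn0 (d_eq _ _).2 //.
  by rewrite lerDl ltW.
have [r r0 tri] := wtri e0; have [N1 H1] := IH _ r0.
have [N2 H2] := iter_psi_lt (d_ge x (T x)) r0.
exists (maxn N1 N2) => n; rewrite geq_max => /andP[n1 n2].
apply: (tri _ (iter (n + j) T x)); first exact: H1.
rewrite addnS iterSr; apply: (le_trans (d_iter _ _ _)).
by apply/ltW/H2/(leq_trans n2)/leq_addr.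
Qed.

Lemma orbit_bounded x :
  exists N, forall j, d (iter N T x) (iter (N + j) T x) <= a + 1.
Proof.
have [r r0 tri] := wtri (@ltr01 R).
(* A successor is chosen so that the shift is positive and [j - m < j] holds in the strong induction
   below. *)
have [|m /(_ m.+1 (leqnSn m)) /ltW] := @iter_psi_lt (a + 1) r _ r0.
  by rewrite lerDl.
have : (0 < m.+1)%N by [].
move: m.+1 => {}m m0 pm.
(* The bound [r] serves as one leg of the weak triangle inequality; the bound 1 settles [j <= m]
   directly. *)
have [N HN] : exists N, forall n, (N <= n)%N -> forall j, (j <= m)%N ->
    d (iter n T x) (iter (n + j) T x) <= a + Num.min r 1.
  have rm : 0 < Num.min r 1 by rewrite lt_min r0 ltr01.
  elim: m {m0 pm} => [|m [N1 H1]].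
    have [N HN] := orbit_shift_small x 0 rm.
    by exists N => n Nn j; rewrite leqn0 => /eqP ->; exact: HN.
  have [N2 H2] := orbit_shift_small x m.+1 rm.
  exists (maxn N1 N2) => n; rewrite geq_max => /andP[n1 n2] j.
  by rewrite leq_eqVlt ltnS => /predU1P[->|jm]; [exact: H2|exact: H1].
exists N => j; elim/ltn_ind: j => j IH.
have [jm|mj] := leqP j m.
  by apply: (le_trans (HN _ _ _ jm)) => //; rewrite lerD2l ge_min lexx orbT.
apply: (tri _ (iter (N + m) T x)).
  by apply: (le_trans (HN _ _ _ (leqnn m))) => //; rewrite lerD2l ge_min lexx.
(* The second leg joins the [m]-fold images of the points with indices [N] and [N + (j - m)]; the
   induction hypothesis bounds it by [iter m psi (a + 1) <= a + r]. *)
have jE : (N + j = m + (N + (j - m)))%N by rewrite addnCA subnKC // ltnW.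
rewrite jE addnC 2!iterD; apply: (le_trans (d_iter _ _ _)).
apply: le_trans pm; apply: iter_psi_nd => //; apply: IH.
by rewrite ltn_subrL m0 (leq_trans m0 (ltnW mj)).
Qed.

Lemma orbit_cauchy x : O_cauchy a d (fun n => iter n T x).
Proof.
have [N HN] := orbit_bounded x.
apply/cvgrPdist_lt => e e0.
have [|M HM] := @iter_psi_lt (a + 1) e _ e0; first by rewrite lerDl.
have H p q : (N + M <= p)%N -> (p <= q)%N ->
    d (iter p T x) (iter q T x) < a + e.
  move=> Mp pq; have Np : (N <= p)%N := leq_trans (leq_addr _ _) Mp.
  apply: le_lt_trans (HM (p - N)%N _); last by rewrite leq_subRL.
  (* Both points are images under [p - N >= M] iterations of points whose distance [HN] bounds by
     [a + 1]. *)
  have pE : p = (p - N + N)%N by rewrite subnK.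
  have qE : q = (p - N + (N + (q - p)))%N by rewrite addnA subnK // subnKC.
  rewrite {1}pE qE 2!iterD; apply: (le_trans (d_iter _ _ _)).
  by apply: iter_psi_nd.
exists ([set n | (N + M <= n)%N], [set n | (N + M <= n)%N]).
  by split; exists (N + M)%N.
move=> [p q] [/= Mp Mq]; rewrite ler0_norm ?subr_le0 // opprB ltrBlDl.
have [pq|/ltnW qp] := leqP p q; first exact: H.
by rewrite d_sym; exact: H.
Qed.

Lemma orbit_limit_fixed x z : O_cvg a d (fun n => iter n T x) z -> T z = z.
Proof.
move=> xz; symmetry; apply: d_le_eps_eq => e /wtri[r r0 tri].
have ar : a < a + r by rewrite ltrDl.
have [N _ HN] := cvgr_lt _ xz _ ar.
apply: (tri _ (iter N.+1 T x)).
  by rewrite d_sym; apply/ltW/HN => /=.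
(* Since [psi] lies below the identity, the distance from [iter N.+1 T x] to [T z] is at most that
   from [iter N T x] to [z]. *)
apply: (le_trans (d_T _ _)); apply: (le_trans (psi_le_id (d_ge _ _))).
exact/ltW/HN/leqnn.
Qed.

End Orbits.

Lemma weak_triangle_of_nondecreasing (R : realType) (X : Type) (a : R)
    (d : X -> X -> R) (psi : R -> R) (f : 'rV[R]_2 -> R) :
  (forall x y, a <= d x y) ->
  (forall t, a < t -> a < psi t) ->
  nondecreasing_in_each_variable `[a, +oo[ f ->
  (forall x : nat -> X,
     d (x 0%N) (x 2%N) <= f (\row_(i < 2) d (x i) (x i.+1))) ->
  f (\row_(j < 2) iter j.+1 psi t) @[t --> a^'+] --> a ->
  weak_triangle a d.
Proof.
move=> d_ge psi_gt fnd df fa e e0.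
have ae : a < a + e by rewrite ltrDl.
have [t [at_ ft]] : exists t, a < t /\
    f (\row_(j < 2) iter j.+1 psi t) < a + e.
  apply: (@filter_ex _ (a^'+)); near=> t; split.
    by near: t; exact: nbhs_right_gt.
  by near: t; exact: (cvgr_lt _ fa _ ae).
have p1 := psi_gt _ at_; have p2 := psi_gt _ p1.
(* With this radius the two legs are at most [psi t] and [psi (psi t)], the very arguments at which
   [f] is below [a + e]. *)
exists (Num.min (psi t) (psi (psi t)) - a); first by rewrite subr_gt0 lt_min p1.
move=> x y z; rewrite addrC subrK !le_min => /andP[xy _] /andP[_ yz].
(* The default [x] of [nth] is immaterial: only indices 0, 1 and 2 are read. *)
have := df (nth x [:: x; y; z]) => /= dxz.
apply: (le_trans dxz); apply: le_trans (ltW ft).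
apply: (nondecreasing_in_each_variable_le fnd) => i; rewrite !mxE.
- by rewrite in_itv /= andbT.
- by rewrite in_itv /= andbT; case: i => -[|[|]] //= _; rewrite ltW.
- by case: i => -[|[|]] //=.
Unshelve. all: by end_near.
Qed.

Unset Implicit Arguments.
Set Strict Implicit.

Theorem theorem3p2 (R : realType) (X : Type) (a : R)
    (o : R -> R -> R) (d : X -> X -> R)
    (Delta : forall n : nat, 'rV[R]_n -> R)
    (T : X -> X) (psi : R -> R)
    (hX : O_metric_space a `[a, +oo[ o d)
    (hcomplete : O_complete a d)
    (hDelta_ge0 : forall n, (0 < n)%N ->
       forall v, cube `[a, +oo[ n v -> 0 <= Delta n v)
    (hi : forall x1 x2 : X, d x1 x2 = a <-> x1 = x2)
    (hii : forall x1 x2 : X, d x1 x2 = d x2 x1)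
    (hiii : forall n, (0 < n)%N ->
       nondecreasing_in_each_variable `[a, +oo[ (Delta n) /\
       forall x : nat -> X,
         d (x 0%N) (x n) <= Delta n (\row_(i < n) d (x i) (x i.+1)))
    (hT : forall x y : X, d (T x) (T y) <= psi (d x y))
    (hpsi_itv : {in `[a, +oo[, forall t, psi t \in `[a, +oo[})
    (hpsi_nondecr : {in `[a, +oo[ &, {homo psi : s t / s <= t}})
    (hpsi_cont : continuous_at_within [set` `[a, +oo[] psi a)
    (hpsi_a : psi a = a)
    (hiv : {in `[a, +oo[, forall t, iter n psi t @[n --> \oo] --> a})
    (hv : forall i, (0 < i)%N ->
       Delta i (\row_(j < i) iter j.+1 psi t) @[t --> a^'+] --> a)
    (hor : continuous (T : O_space a d -> O_space a d) \/
       (continuous_at_within (cube `[a, +oo[ 2) (Delta 2%N) (const_mx a) /\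
        Delta 2%N (const_mx a) = a)) :
  exists! x : X, T x = x.
Proof.
case: hX => -[x0] _ _ _ _ dI _ _ _.
have d_ge x y : a <= d x y by have := dI x y; rewrite in_itv /= andbT.
have inI t : (t \in `[a, +oo[) = (a <= t) by rewrite in_itv /= andbT.
have psi_ge t : a <= t -> a <= psi t by rewrite -!inI; exact: hpsi_itv.
have psi_nd s t : a <= s -> s <= t -> psi s <= psi t.
  by move=> as_ st; apply: hpsi_nondecr; rewrite ?inI // (le_trans as_).
have psi_cvg t : a <= t -> iter n psi t @[n --> \oo] --> a.
  by rewrite -inI; exact: hiv.
suff [z Tz] : exists z, T z = z.
  by exists z; split=> // y Ty; exact: (contraction_fixed_unique d_ge hi hT).
have [[t [at_ pt]]|npsi] := pselect (exists t, a < t /\ psi t = a).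
  exact: (orbit_reaches_fixed d_ge hi hT psi_ge psi_nd psi_cvg x0 at_ pt).
have psi_gt t : a < t -> a < psi t.
  move=> at_; rewrite lt_neqAle psi_ge ?ltW // andbT eq_sym.
  by apply/eqP => pt; apply: npsi; exists t.
have [D2nd D2d] := hiii 2%N isT.
have wtri := weak_triangle_of_nondecreasing d_ge psi_gt D2nd D2d (hv 2%N isT).
have [z xz] := hcomplete _
  (orbit_cauchy d_ge hii hi hT psi_ge psi_nd psi_cvg wtri x0).
exists z.
exact: (orbit_limit_fixed d_ge hii hi hT psi_nd psi_cvg wtri xz).
Qed.
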